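(* Let $n\ge 2$ and let $D=p(x_1)\partial_{x_1}+\sum_{i=2}^n q_i(x_1,x_i)\partial_{x_i}$ be a simple derivation of $K[x]$, where $p(x_1)\in K[x_1]$ and $q_i(x_1,x_i)\in K[x_1,x_i]$ for all $2\le i\le n$. Suppose that for every $f\in\operatorname{Aut}(K[x])_D$ one has $f-f(0)\in\operatorname{Aut}(K[x])_D$. Then $\operatorname{Aut}(K[x])_D=\{\mathrm{id}\}$.
   Context: $K$ is a field of characteristic zero, $K[x]=K[x_1,\ldots,x_n]$, and $\partial_{x_i}=\partial/\partial x_i$. A $K$-derivation $D$ of $K[x]$ is a $K$-linear map $K[x]\to K[x]$ with $D(ab)=D(a)b+aD(b)$. An ideal $I$ is $D$-stable if $D(I)\subset I$; $D$ is simple if the only $D$-stable ideals of $K[x]$ are $0$ and $K[x]$. Invertible polynomial maps $f=(f_1,\ldots,f_n)$ (polynomial maps $K^n\to K^n$ with a polynomial inverse) are identified with $K$-automorphisms $\rho$ of $K[x]$ via $\rho(g)=g(f_1,\ldots,f_n)$, i.e. $\rho(x_i)=f_i$. $\operatorname{Aut}(K[x])$ is the group of $K$-automorphisms of $K[x]$ and $\operatorname{Aut}(K[x])_D=\{\rho\in\operatorname{Aut}(K[x]) : \rho D=D\rho\}$. Write $f(0)=(f_1(0,\ldots,0),\ldots,f_n(0,\ldots,0))\in K^n$ and $f-f(0)=(f_1-f_1(0),\ldots,f_n-f_n(0))$. *)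

(* Defs.v *)
From HB Require Import structures.
From mathcomp Require Export all_boot all_order all_algebra.
From mathcomp Require Export mpoly.

Set Implicit Arguments.
Unset Strict Implicit.
Unset Printing Implicit Defensive.

Import GRing.Theory.
Local Open Scope ring_scope.

Section Defs.
Variables (K : fieldType) (n : nat).
Local Notation Kx := {mpoly K[n]}.

Definition is_derivation (D : Kx -> Kx) : Prop :=
  linear D /\ (forall a b : Kx, D (a * b) = D a * b + a * D b).

(* Ideals are Prop-valued and may be improper, unlike those of ring_quotient,
   which are boolean and exclude the unit ideal. *)
Definition is_ideal (I : Kx -> Prop) : Prop :=
  [/\ I 0, (forall a b : Kx, I a -> I b -> I (a + b))
         & (forall r a : Kx, I a -> I (r * a))].

Definition stable_ideal (D : Kx -> Kx) (I : Kx -> Prop) : Prop :=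
  forall a : Kx, I a -> I (D a).

Definition simple_derivation (D : Kx -> Kx) : Prop :=
  is_derivation D /\
  (forall I : Kx -> Prop, is_ideal I -> stable_ideal D I ->
     (forall a : Kx, I a -> a = 0) \/ (forall a : Kx, I a)).

Definition is_Kaut (rho : Kx -> Kx) : Prop :=
  [/\ linear rho, monoid_morphism rho & bijective rho].

Definition in_AutD (D rho : Kx -> Kx) : Prop :=
  is_Kaut rho /\ (forall g : Kx, rho (D g) = D (rho g)).

(* The polynomial map f = (f_1, ..., f_n) identified with rho: f_i = rho x_i. *)
Definition polymap (rho : Kx -> Kx) : n.-tuple Kx :=
  [tuple rho 'X_i | i < n].

Definition endo_of_polymap (f : n.-tuple Kx) : Kx -> Kx :=
  fun g => g \mPo f.

(* f - f(0) *)
Definition recenter (f : n.-tuple Kx) : n.-tuple Kx :=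
  [tuple tnth f i - ((tnth f i).@[fun=> 0])%:MP | i < n].

End Defs.

(* Main.v *)
Require Import Defs.
Set Implicit Arguments.
Unset Strict Implicit.
Unset Printing Implicit Defensive.
Import GRing.Theory.
Local Open Scope ring_scope.

(** Write D = p d_1 + sum q_i d_i, where d_i is the i-th partial derivative.

    The principal ideal of a polynomial u with D u = r u is D-stable, so
    simplicity forces every such u to be a constant
    ([simple_darboux_const]).  Three consequences carry the proof.

    - D x_1 = p(x_1) divides its own image under D, hence is a constant c, and
      c is nonzero because otherwise x_1 would generate a stable ideal.

    - An automorphism rho commuting with D and fixing a point is the identity
      ([simple_fixed_point_id]): the polynomials all of whose iterates under D
      vanish at that point form a proper stable ideal, hence zero, and each
      rho(g) - g belongs to it.  Since f - f(0) fixes the origin, the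
      assumption says that f - f(0) is the identity for every f in the
      isotropy group, so that f is a translation by some vector v.

    - Such a translation leaves each Q = q_i(x_1, x_i) = D x_i invariant.  In
      characteristic zero this means that v_1 d_1 Q + v_i d_i Q = 0
      ([translation_invariant_deriv]).  Then w = v_1 Q - c v_i, which is up to
      sign the determinant of D and v in the coordinates x_1 and x_i,
      satisfies D w = (d_i Q) w, so that w is constant and v_1 d_i Q = 0.
      Now d_i Q is nonzero ([simple_coef_dep]): otherwise Q would lie in
      K[x_1] and have an antiderivative P there, so that D would kill the
      nonconstant polynomial c x_i - P.  Hence v_1 = 0, and then v_i = 0 by the
      relation above.  As n >= 2 there is an i to which this applies, and
      v = 0. *)

(** * Partial derivatives in characteristic zero *)

(** The form of induction adapted to morphisms and derivations: a property
    stable under ring operations is only checked on constants and variables. *)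
Lemma mpoly_alg_ind (R : comNzRingType) (n : nat) (P : {mpoly R[n]} -> Prop) :
  (forall c, P c%:MP) -> (forall i, P 'X_i) ->
  (forall a b, P a -> P b -> P (a + b)) ->
  (forall a b, P a -> P b -> P (a * b)) -> forall g, P g.
Proof.
move=> PC PX PD PM; elim/mpolyind=> [|c m g _ _ Pg].
  by rewrite -(mpolyC0 n); apply: PC.
apply: PD => //; rewrite -mul_mpolyC; apply: (PM) => //.
rewrite mpolyXE_id; apply: (big_ind P) => [||i _].
- by rewrite -mpolyC1; apply: PC.
- exact: PM.
elim: (m i) => [|k IH]; first by rewrite expr0 -mpolyC1.
by rewrite exprS; apply: PM.
Qed.

Section CharZero.

Variable (K : fieldType).
Hypothesis charK0 : [pchar K] =i pred0.

Lemma natr_inj_char0 : injective (fun k : nat => k%:R : K).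
Proof.
move=> a b; wlog leab: a b / (a <= b)%N => [W e|/esym/eqP].
  by case/orP: (leq_total a b) => /W W'; [apply: W' | apply/esym/W'].
rewrite -subr_eq0 -natrB // (GRing.pcharf0P K).1 // subn_eq0 => leba.
by apply/eqP; rewrite eqn_leq leab leba.
Qed.

Variable (n : nat).
Local Notation Kx := {mpoly K[n]}.
Implicit Types (g : Kx) (v : 'I_n -> K).

Lemma mderiv_var (i j : 'I_n) : ('X_j : Kx)^`M(i) = (i == j)%:R.
Proof.
rewrite mderivX mnm1E eq_sym; case: eqP => [->|_]; last by rewrite scale0r.
by rewrite -[X in (X - _)%MM]add0m addmK mpolyX0 scale1r.
Qed.

Lemma msupp_mderiv0 (j : 'I_n) g m :
  g^`M(j) = 0 -> m \in msupp g -> m j = 0%N.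
Proof.
move=> dg0; rewrite mcoeff_msupp => gm; apply/eqP.
apply: contraNT gm => mj.
have Um : (U_(j) <= m)%MM by rewrite lep1mP.
have := congr1 (mcoeff (m - U_(j))) dg0.
rewrite mcoeff_mderiv mcoeff0 submK // -mulr_natr => /eqP.
by rewrite mulf_eq0 ((GRing.pcharf0P K).1 charK0) // orbF.
Qed.

(** Monomials are integrated one by one with respect to the variable [o]; the
    remaining exponents do not change, so that a variable absent from [g] is
    also absent from its antiderivative. *)
Lemma mpoly_antiderivative (o : 'I_n) g :
  exists P : Kx, P^`M(o) = g /\
    forall j, j != o -> g^`M(j) = 0 -> P^`M(j) = 0.
Proof.
exists (\sum_(m <- msupp g) (g@_m / (m o).+1%:R) *: 'X_[m + U_(o)]).
split=> [|j jo dg0]; rewrite raddf_sum /=.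
  rewrite [RHS]mpolyE; apply: eq_bigr => m _.
  rewrite mderivZ mderivX scalerA mnmDE mnm1E eqxx addn1 addmK divfK //.
  by rewrite ((GRing.pcharf0P K).1 charK0).
rewrite big_seq big1 // => m mg.
rewrite mderivZ mderivX mnmDE mnm1E eq_sym (negbTE jo) addn0.
by rewrite (msupp_mderiv0 dg0 mg) scale0r scaler0.
Qed.

Lemma mderiv_comp0 k (q : {mpoly K[k]}) (f : k.-tuple Kx) j :
  (forall i, (tnth f i)^`M(j) = 0) -> (q \mPo f)^`M(j) = 0.
Proof.
move=> df; elim/mpoly_alg_ind: q => [c|i|a b da db|a b da db].
- by rewrite comp_mpolyC mderivC.
- by rewrite comp_mpolyXU -tnth_nth.
- by rewrite comp_mpolyD mderivD da db addr0.
- by rewrite rmorphM /= mderivM da db mul0r mulr0 addr0.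
Qed.

(** The polynomial t |-> g(x + t v), with coefficients in K[x]. *)
Definition line_restriction v : Kx -> {poly Kx} :=
  mmap (polyC \o @mpolyC n K) (fun i => ('X_i : Kx)%:P + ((v i)%:MP : Kx)%:P * 'X).

Lemma line_restrictionC v c : line_restriction v c%:MP = c%:MP%:P.
Proof. exact: mmapC. Qed.

Lemma line_restrictionX v i :
  line_restriction v 'X_i = ('X_i)%:P + (v i)%:MP%:P * 'X.
Proof. by rewrite /line_restriction mmapX mmap1U. Qed.

Lemma line_restrictionD v : {morph line_restriction v : a b / a + b}.
Proof. exact: mmapD. Qed.

Lemma line_restrictionM v : {morph line_restriction v : a b / a * b}.
Proof. exact: rmorphM. Qed.

Lemma line_restriction_nat v g (k : nat) :
  (line_restriction v g).[k%:R] =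
    g \mPo [tuple 'X_i + (v i *+ k)%:MP | i < n].
Proof.
elim/mpoly_alg_ind: g => [c|i|a b da db|a b da db].
- by rewrite line_restrictionC comp_mpolyC hornerC.
- rewrite line_restrictionX comp_mpolyXU -tnth_nth tnth_mktuple.
  by rewrite !hornerE mulr_natr mpolyCMn.
- by rewrite line_restrictionD hornerD comp_mpolyD; congr (_ + _).
- by rewrite line_restrictionM hornerM rmorphM; congr (_ * _).
Qed.

Lemma line_restriction_deriv v g :
  (line_restriction v g)^`().[0] = \sum_i (v i)%:MP * g^`M(i).
Proof.
have ev0 h : (line_restriction v h).[0] = h.
  rewrite -[0]/(0%:R) line_restriction_nat -[RHS]comp_mpoly_id.
  by congr (_ \mPo _); apply: eq_mktuple => i; rewrite mulr0n mpolyC0 addr0.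
elim/mpoly_alg_ind: g => [c|i|a b da db|a b da db].
- rewrite line_restrictionC derivC horner0 big1 // => i _.
  by rewrite mderivC mulr0.
- rewrite line_restrictionX derivD derivC derivM derivC derivX !hornerE.
  rewrite (bigD1 i) //= mderiv_var eqxx mulr1 big1 ?addr0 // => j ji.
  by rewrite mderiv_var (negbTE ji) mulr0.
- rewrite line_restrictionD derivD hornerD [LHS](congr2 +%R da db) -big_split /=.
  by apply: eq_bigr => i _; rewrite mderivD mulrDr.
- rewrite line_restrictionM derivM hornerD !hornerM.
  rewrite [X in X + _](congr2 *%R da (ev0 b)).
  rewrite [X in _ + X](congr2 *%R (ev0 a) db).
  rewrite mulr_suml mulr_sumr -big_split /=; apply: eq_bigr => i _.
  by rewrite mderivM mulrDr -mulrA [a * _]mulrCA.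
Qed.

(** If g(x + k v) = g(x) for every natural number k, the polynomial
    g(x + t v) - g(x) in t has infinitely many roots in characteristic zero.
    It vanishes identically, and so does its derivative at t = 0. *)
Lemma translation_invariant_deriv v g :
  (forall k : nat, g \mPo [tuple 'X_i + (v i *+ k)%:MP | i < n] = g) ->
  \sum_i (v i)%:MP * g^`M(i) = 0.
Proof.
move=> inv; rewrite -line_restriction_deriv.
set r := line_restriction v g.
suff -> : r = g%:P by rewrite derivC horner0.
apply/eqP; rewrite -subr_eq0; apply/negP => /negP nz.
(* Were r - g nonzero, the naturals below its size would be too many roots. *)
have /(max_poly_roots nz) : all (root (r - g%:P))
    [seq k%:R | k <- iota 0 (size (r - g%:P))].
  apply/allP => _ /mapP[k _ ->].
  by rewrite /root !hornerE line_restriction_nat inv subrr.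
rewrite size_map size_iota ltnn => H.
suff: false by []; apply: H.
rewrite map_inj_uniq ?iota_uniq // => a b.
by rewrite -!mpolyC_nat => /(can_inj (@mpolyCK n K)) /natr_inj_char0.
Qed.

End CharZero.

(** * Derivations *)

Section Derivations.

Variables (K : fieldType) (n : nat).
Local Notation Kx := {mpoly K[n]}.
Variable D : Kx -> Kx.
Hypothesis derD : is_derivation D.

Let linD : linear D. Proof. by case: derD. Qed.
Let leibD a b : D (a * b) = D a * b + a * D b. Proof. by case: derD. Qed.

Lemma derivationD a b : D (a + b) = D a + D b.
Proof. by rewrite -[a]scale1r linD !scale1r. Qed.

Lemma derivation0 : D 0 = 0.
Proof. by apply: (addrI (D 0)); rewrite -derivationD !addr0. Qed.

Lemma derivationB a b : D (a - b) = D a - D b.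
Proof. by rewrite -scaleN1r addrC linD scaleN1r addrC. Qed.

Lemma derivationZ s a : D (s *: a) = s *: D a.
Proof. by rewrite -[s *: a]addr0 linD derivation0 addr0. Qed.

Lemma derivationC s : D s%:MP = 0.
Proof.
have D1 : D 1 = 0.
  apply: (addrI (D 1)).
  by rewrite -{1}[D 1]mulr1 -{2}[D 1]mul1r -leibD mulr1 addr0.
by rewrite -[s%:MP]mulr1 mul_mpolyC derivationZ D1 scaler0.
Qed.

Lemma derivation_coordE g : D g = \sum_j D 'X_j * g^`M(j).
Proof.
elim/mpoly_alg_ind: g => [c|i|a b da db|a b da db].
- by rewrite derivationC big1 // => j _; rewrite mderivC mulr0.
- rewrite (bigD1 i) //= mderiv_var eqxx mulr1 big1 ?addr0 // => j ji.
  by rewrite mderiv_var (negbTE ji) mulr0.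
- rewrite derivationD da db -big_split /=.
  by apply: eq_bigr => j _; rewrite mderivD mulrDr.
- rewrite leibD da db mulr_suml mulr_sumr -big_split /=.
  by apply: eq_bigr => j _; rewrite mderivM mulrDr -mulrA [a * _]mulrCA.
Qed.

Lemma iter_derivationD k a b : iter k D (a + b) = iter k D a + iter k D b.
Proof. by elim: k => [//|k IH]; rewrite /= IH derivationD. Qed.

(** By the Leibniz rule, the polynomials all of whose iterated derivatives are
    killed by the ring morphism [e] are closed under multiplication by K[x]. *)
Lemma iter_derivation_vanish (e : {rmorphism Kx -> K}) a :
  (forall k, e (iter k D a) = 0) -> forall k r, e (iter k D (r * a)) = 0.
Proof.
move=> ea k; elim: k a ea => [|k IH] a ea r.
  by rewrite /= rmorphM (ea 0%N) mulr0.
rewrite iterSr leibD iter_derivationD rmorphD IH // add0r.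
by apply: IH => j; rewrite -iterSr.
Qed.

End Derivations.

(** * Simple derivations *)

Section SimpleDerivations.

Variables (K : fieldType) (n : nat).
Local Notation Kx := {mpoly K[n]}.
Variable D : Kx -> Kx.
Hypothesis simD : simple_derivation D.

Let derD : is_derivation D := simD.1.

(** The principal ideal (u) is stable, hence it is zero or contains 1; in the
    latter case u is a unit of the polynomial ring. *)
Lemma simple_darboux_const u r : D u = r * u -> exists c, u = c%:MP.
Proof.
move=> Du; have [||u0|u1] := simD.2 (fun a => exists b, a = b * u).
- split=> [|a b [a' ->] [b' ->]|s a [a' ->]]; first by exists 0; rewrite mul0r.
    by exists (a' + b'); rewrite mulrDl.
  by exists (s * a'); rewrite mulrA.
- move=> _ [b ->]; exists (D b + b * r).
  by rewrite derD.2 Du mulrA -mulrDl.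
- by exists 0; rewrite mpolyC0; apply: u0; exists 1; rewrite mul1r.
have [b /esym /mpoly_intro_unit /andP[/eqP -> _]] := u1 1.
by exists u@_0.
Qed.

(** The point fixed by [rho] is given by the evaluation [e].  The ideal used is
    the largest stable ideal inside the kernel of [e]. *)
Lemma simple_fixed_point_id rho (e : {rmorphism Kx -> K}) :
  in_AutD D rho -> (forall g, e (rho g) = e g) -> rho =1 id.
Proof.
move=> [_ comm] fixe g.
have [||I0|I1] := simD.2 (fun a => forall k, e (iter k D a) = 0).
- split=> [k|a b ea eb k|r a ea k]; last exact: (iter_derivation_vanish derD).
    by elim: k => [|k IH]; rewrite ?rmorph0 // iterSr (derivation0 derD).
  by rewrite (iter_derivationD derD) rmorphD ea eb addr0.
- by move=> a ea k; rewrite -iterSr.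
- apply/eqP; rewrite -subr_eq0; apply/eqP/I0 => k.
  suff -> : iter k D (rho g - g) = rho (iter k D g) - iter k D g.
    by rewrite rmorphB fixe subrr.
  by elim: k => [//|k IH]; rewrite /= IH (derivationB derD) comm.
- by have /eqP := I1 1 0%N; rewrite /= rmorph1 oner_eq0.
Qed.

(** Under this hypothesis [D 'X_o] divides its own derivative, so that it is
    constant; were it zero, ['X_o] would generate a stable ideal. *)
Lemma simple_var_const (o : 'I_n) :
  (forall j, j != o -> (D 'X_o)^`M(j) = 0) ->
  exists2 c, c != 0 & D 'X_o = c%:MP.
Proof.
move=> hp; have [c Dc] : exists c, D 'X_o = c%:MP.
  apply: (@simple_darboux_const _ (D 'X_o)^`M(o)).
  rewrite (derivation_coordE derD) (bigD1 o) //= big1 ?addr0 1?mulrC // => j jo.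
  by rewrite hp // mulr0.
exists c => //; apply/negP => /eqP c0.
have [|d Xd] := @simple_darboux_const 'X_o 0.
  by rewrite Dc c0 mpolyC0 mul0r.
have /eqP := mderiv_var K o o.
by rewrite Xd mderivC eqxx eq_sym oner_eq0.
Qed.

Hypothesis charK0 : [pchar K] =i pred0.
Variables (o i : 'I_n) (c : K).
Hypotheses (io : i != o) (c0 : c != 0) (Do : D 'X_o = c%:MP).
Hypothesis Di : forall j, j != o -> j != i -> (D 'X_i)^`M(j) = 0.

(** Otherwise [D 'X_i] would depend on the variable [o] only; subtracting from
    [c *: 'X_i] an antiderivative of it would give a nonconstant polynomial
    killed by [D]. *)
Lemma simple_coef_dep : (D 'X_i)^`M(i) != 0.
Proof.
apply/negP => /eqP dii.
have [P [dP dP0]] := mpoly_antiderivative charK0 o (D 'X_i).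
have {}dP0 j : j != o -> P^`M(j) = 0.
  by move=> jo; apply: dP0 => //; have [->|/Di->] := eqVneq j i.
have DP : D P = c *: D 'X_i.
  rewrite (derivation_coordE derD) (bigD1 o) //= dP Do mul_mpolyC.
  by rewrite big1 ?addr0 // => j jo; rewrite dP0 // mulr0.
have [|d Xd] := @simple_darboux_const (c *: 'X_i - P) 0.
  by rewrite (derivationB derD) DP (derivationZ derD) subrr mul0r.
have := congr1 (mderiv i) Xd.
rewrite mderivC mderivB mderivZ mderiv_var eqxx dP0 // subr0 => /eqP.
by rewrite scaler_eq0 (negbTE c0) oner_eq0.
Qed.

(** Under this assumption the directional derivative along [v] commutes with
    [D] on polynomials in the variables [o] and [i].  The determinant of the two
    in these variables then generates a stable ideal, hence is constant, and
    this contradicts [simple_coef_dep] unless [v] vanishes at [o]. *)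
Lemma simple_no_translation v :
  \sum_j (v j)%:MP * (D 'X_i)^`M(j) = 0 -> v o = 0 /\ v i = 0.
Proof.
set Q := D 'X_i; move=> Ev.
have {}Ev : (v o)%:MP * Q^`M(o) + (v i)%:MP * Q^`M(i) = 0.
  move: Ev; rewrite (bigD1 o) //= (bigD1 i) //= big1 ?addr0 // => j /andP[jo ji].
  by rewrite Di ?mulr0.
have DQ : D Q = c%:MP * Q^`M(o) + Q * Q^`M(i).
  rewrite (derivation_coordE derD) (bigD1 o) //= (bigD1 i) //= big1 ?addr0 ?Do //.
  by move=> j /andP[jo ji]; rewrite Di ?mulr0.
(* The determinant of v and D, whose components at o and i are c and Q. *)
have [|d wd] := @simple_darboux_const (v o *: Q - (c * v i)%:MP) Q^`M(i).
  rewrite (derivationB derD) (derivationZ derD) (derivationC derD) DQ.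
  rewrite subr0 -!mul_mpolyC mpolyCM mulrDr mulrCA.
  rewrite (canRL (addrK _) Ev) sub0r mulrN addrC.
  by rewrite [RHS]mulrC mulrBl -!mulrA.
have dQ := simple_coef_dep.
have vo : v o = 0.
  have := congr1 (mderiv i) wd.
  rewrite mderivB mderivZ !mderivC subr0 => /eqP.
  by rewrite scaler_eq0 (negbTE dQ) orbF => /eqP.
split=> //; move/eqP: Ev; rewrite vo mpolyC0 mul0r add0r mulf_eq0 (negbTE dQ).
by rewrite orbF mpolyC_eq0 => /eqP.
Qed.

End SimpleDerivations.

(** * Automorphisms and translations *)

Section Automorphisms.

Variables (K : fieldType) (n : nat).
Local Notation Kx := {mpoly K[n]}.
Variable rho : Kx -> Kx.
Hypotheses (lin : linear rho) (mul : monoid_morphism rho).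

Lemma Kaut_compE g : rho g = g \mPo polymap rho.
Proof.
have addr a b : rho (a + b) = rho a + rho b.
  by rewrite -[a]scale1r lin !scale1r.
have rho0 : rho 0 = 0 by apply: (addrI (rho 0)); rewrite -addr !addr0.
elim/mpoly_alg_ind: g => [c|i|a b da db|a b da db].
- rewrite comp_mpolyC -[c%:MP]mulr1 mul_mpolyC -[c *: 1]addr0 lin rho0.
  by rewrite mul.1 !addr0.
- by rewrite comp_mpolyXU -tnth_nth tnth_mktuple.
- by rewrite addr da db comp_mpolyD.
- by rewrite mul.2 da db rmorphM.
Qed.

End Automorphisms.

Lemma iter_translation (K : fieldType) (n : nat) (v : 'I_n -> K)
    (g : {mpoly K[n]}) (k : nat) :
  iter k (comp_mpoly [tuple 'X_i + (v i)%:MP | i < n]) g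
  = g \mPo [tuple 'X_i + (v i *+ k)%:MP | i < n].
Proof.
elim: k => [|k IH].
  rewrite -[LHS]comp_mpoly_id; congr (_ \mPo _).
  by apply: eq_mktuple => i; rewrite mulr0n mpolyC0 addr0.
rewrite iterS IH; elim/mpoly_alg_ind: g {IH} => [c|i|a b da db|a b da db].
- by rewrite !comp_mpolyC.
- rewrite !comp_mpolyXU -!tnth_nth !tnth_mktuple comp_mpolyD comp_mpolyC.
  rewrite comp_mpolyXU -tnth_nth tnth_mktuple -addrA -mpolyCD.
  by rewrite mulrS.
- by rewrite !comp_mpolyD; congr (_ + _).
- by rewrite !rmorphM; congr (_ * _).
Qed.

Lemma in_AutD_id (K : fieldType) (n : nat)
    (D rho : {mpoly K[n]} -> {mpoly K[n]}) :
  rho =1 id -> in_AutD D rho.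
Proof.
move=> rid; split=> [|g]; last by rewrite !rid.
split=> [s a b|| ]; first by rewrite !rid.
  by split=> [|a b]; rewrite !rid.
by exists id => a; rewrite !rid.
Qed.

Theorem corollary3p2 (K : fieldType) (charK0 : [pchar K] =i pred0)
    (n : nat) (hn : (2 <= n)%N)
    (p : {poly K}) (q : 'I_n -> {mpoly K[2]})
    (D : {mpoly K[n]} -> {mpoly K[n]})
    (hD : let o := Ordinal (ltnW hn) in
          forall g : {mpoly K[n]},
            D g = (map_poly (@mpolyC n K) p).['X_o] * g^`M(o)
                + \sum_(i < n | i != o) (q i \mPo [tuple 'X_o; 'X_i]) * g^`M(i))
    (hsimple : simple_derivation D)
    (hrecenter : forall rho : {mpoly K[n]} -> {mpoly K[n]},
        in_AutD D rho ->
        in_AutD D (endo_of_polymap (recenter (polymap rho)))) :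
  forall rho : {mpoly K[n]} -> {mpoly K[n]}, in_AutD D rho <-> rho =1 id.
Proof.
move=> rho; split=> [rhoD|]; last exact: in_AutD_id.
move: hD; set o := Ordinal (ltnW hn) => {}hD.
have derD := hsimple.1.
have DXo : D 'X_o = (map_poly (@mpolyC n K) p).['X_o].
  rewrite hD mderiv_var eqxx mulr1 big1 ?addr0 // => i io.
  by rewrite mderiv_var (negbTE io) mulr0.
have DX i : i != o -> D 'X_i = q i \mPo [tuple 'X_o; 'X_i].
  move=> io; rewrite hD mderiv_var eq_sym (negbTE io) mulr0 add0r.
  rewrite (bigD1 i) //= mderiv_var (eqxx i) mulr1 big1 ?addr0 // => j /andP[_ ji].
  by rewrite mderiv_var (negbTE ji) mulr0.
have dDXi i : i != o ->
    forall j, j != o -> j != i -> (D 'X_i)^`M(j) = 0.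
  move=> io j jo ji; rewrite DX //; apply: mderiv_comp0.
  case=> [[|[|//]]] lt2; rewrite (tnth_nth 0) /= mderiv_var.
    by rewrite (negbTE jo).
  by rewrite (negbTE ji).
have [|c c0 Do] := @simple_var_const _ _ _ hsimple o.
  move=> j jo; rewrite DXo; elim/poly_ind: (p) => [|r a IH].
    by rewrite map_poly0 horner0 mderiv0.
  rewrite rmorphD rmorphM /= map_polyX map_polyC /= hornerMXaddC.
  by rewrite mderivD mderivM mderivC IH mderiv_var (negbTE jo) mul0r mulr0 !addr0.
pose v i := (rho 'X_i).@[fun=> 0].
have rhoX i : rho 'X_i = 'X_i + (v i)%:MP.
  have fix0 g : (endo_of_polymap (recenter (polymap rho)) g).@[fun=> 0]
      = g.@[fun=> 0].
    rewrite /endo_of_polymap comp_mpoly_meval; apply: meval_eq => j.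
    by rewrite !tnth_mktuple mevalB mevalC subrr.
  have /(_ 'X_i) := simple_fixed_point_id hsimple (hrecenter _ rhoD) fix0.
  rewrite /endo_of_polymap comp_mpolyXU -tnth_nth !tnth_mktuple /=.
  by move/eqP; rewrite subr_eq => /eqP.
have [[lin mul _] comm] := rhoD.
have rhoE g : rho g = g \mPo [tuple 'X_i + (v i)%:MP | i < n].
  rewrite (Kaut_compE lin mul); congr (_ \mPo _).
  exact: eq_mktuple.
have noT i : i != o -> v o = 0 /\ v i = 0.
  move=> io.
  apply: (simple_no_translation hsimple charK0 io c0 Do (dDXi i io)).
  apply: translation_invariant_deriv => // k.
  rewrite -iter_translation; elim: k => [//|k IH].
  rewrite iterS IH -rhoE comm rhoX.
  rewrite !(derivation_coordE derD); apply: eq_bigr => j _.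
  by rewrite mderivD mderivC addr0.
have v0 i : v i = 0.
  have [->|/noT[]//] := eqVneq i o.
  (* As n >= 2, some index differs from o and yields v_o = 0. *)
  by have [] := noT (Ordinal hn) isT.
move=> g; rewrite rhoE -[RHS]comp_mpoly_id; congr (_ \mPo _).
by apply: eq_mktuple => i; rewrite v0 mpolyC0 addr0.
Qed.
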